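(* Let $\mathbf{G}=(G,\alpha,w)$ and $\widetilde{\mathbf{G}}$ be finite MW-graphs with $\widetilde{\mathbf{G}}=\mathbf{G}/\{v_1,v_2\}$ for two different vertices $v_1,v_2$ of $G$. 1. If $\mathbf{G},\widetilde{\mathbf{G}}$ both have combinatorial weights, then $\mathbf{G}\sqsubseteq\widetilde{\mathbf{G}}$ and $\widetilde{\mathbf{G}}\stackrel{r+1-s}{\preccurlyeq}\mathbf{G}$, hence $\mathbf{G}\preccurlyeq\widetilde{\mathbf{G}}\stackrel{r+1-s}{\preccurlyeq}\mathbf{G}$, where $$r=\min\{\deg^G(v_1),\deg^G(v_2)\}\quad\text{and}\quad s=\bigl|\{e\in E:\partial_-e=v_1,\ \partial_+e=v_2,\ \alpha_e=0\}\bigr|.$$ 2. If $\mathbf{G},\widetilde{\mathbf{G}}$ both have standard weights, then $\mathbf{G}\sqsubseteq\widetilde{\mathbf{G}}$ and $\widetilde{\mathbf{G}}\stackrel{1}{\preccurlyeq}\mathbf{G}$, hence $\mathbf{G}\preccurlyeq\widetilde{\mathbf{G}}\stackrel{1}{\preccurlyeq}\mathbf{G}$.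
   Context: Graphs: a graph $G=(V,E,\partial)$ consists of disjoint sets $V$ (vertices) and $E$ (edges), a map $\partial\colon E\to V\times V$, $\partial e=(\partial_-e,\partial_+e)$, and an involution $e\mapsto\bar e$ on $E$ with $e\neq\bar e$ and $\partial_\pm\bar e=\partial_\mp e$. Loops and multiple edges are allowed; $G$ need not be connected. $E_v=\{e\in E:\partial_-e=v\}$, $\deg(v)=\deg^G(v)=|E_v|<\infty$ (a loop contributes $2$). MW-graphs: a weight $w$ consists of $w\colon V\to(0,\infty)$, $w\colon E\to(0,\infty)$. Combinatorial weights: $w(v)=1$, $w_e=1$. Standard weights: $w(v)=\deg(v)$, $w_e=1$ (so no isolated vertices). Fix a subgroup $R$ of $\mathbb{R}/2\pi\mathbb{Z}$; a magnetic potential is $\alpha\colon E\to R$ with $\alpha_{\bar e}=-\alpha_e$. An MW-graph is $\mathbf{G}=(G,\alpha,w)$; finite means $V$ finite, $|\mathbf{G}|=|V|$. Vertex contraction: $\mathbf{G}/\{v_1,v_2\}$ is obtained by identifying $v_1$ and $v_2$ to one vertex while keeping all edges and the magnetic potential: the vertex set is $V/{\sim}$, where $\sim$ identifies exactly $v_1$ and $v_2$, the edge set is $E$, $\widetilde\partial e=([\partial_-e],[\partial_+e])$, $\widetilde\alpha=\alpha$. Edges joining $v_1$ and $v_2$ become loops. The weights are the combinatorial (resp. standard) weights of the new graph. $\mathbf{G}\sqsubseteq\mathbf{G}'$ means that there is an MW-homomorphism $\pi\colon\mathbf{G}\to\mathbf{G}'$, i.e. maps $\pi\colon V\to V'$,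 $\pi\colon E\to E'$ with $\pi(\partial_\pm e)=\partial'_\pm(\pi e)$, $\alpha_e=\alpha'_{\pi e}$ for all $e\in E$, $\sum_{\pi(v)=v'}w(v)\ge w'(v')$ for all $v'\in V'$, and $\sum_{\pi(e)=e'}w_e\le w'_{e'}$ for all $e'\in E'$. Spectral preorder: $\lambda_1(\mathbf{G})\le\dots\le\lambda_{|\mathbf{G}|}(\mathbf{G})$ are the eigenvalues, with multiplicity, of the magnetic Laplacian $(\Delta_\alpha\varphi)(v)=\frac1{w(v)}\sum_{e\in E_v}w_e\bigl(\varphi(v)-\mathrm{e}^{\mathrm{i}\alpha_e}\varphi(\partial_+e)\bigr)$, self-adjoint on $\ell_2(V,w)$. For $r\in\mathbb{N}_0$, $\mathbf{G}\stackrel{r}{\preccurlyeq}\mathbf{G}'$ means $|\mathbf{G}|\ge|\mathbf{G}'|-r$ and $\lambda_k(\mathbf{G})\le\lambda_{k+r}(\mathbf{G}')$ for all $1\le k\le|\mathbf{G}'|-r$; $\preccurlyeq$ means $\stackrel{0}{\preccurlyeq}$; chains mean that both relations hold. *)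

(* Defs.v *)
From HB Require Import structures.
From mathcomp Require Import all_boot all_order all_algebra.
From mathcomp Require Import generic_quotient ring_quotient.
From mathcomp Require Import reals trigo.
From mathcomp Require Import complex.

Set Implicit Arguments.
Unset Strict Implicit.
Unset Printing Implicit Defensive.

Import Order.TTheory GRing.Theory Num.Theory.
Local Open Scope ring_scope.
Local Open Scope quotient_scope.

Section Angle.
Variable R : realType.

Definition twopiZ : {pred R} := [pred x | x / (2 * pi) \is a Num.int].

Fact twopiZ_zmod_closed : zmod_closed twopiZ.
Proof.
split=> [|x y]; first by rewrite inE mul0r.
by rewrite !inE mulrBl => hx hy; rewrite rpredB.
Qed.

HB.instance Definition _ :=
  GRing.isZmodClosed.Build R twopiZ twopiZ_zmod_closed.

(* The additive group R / 2 pi Z. *)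
Definition angle := Quotient.quot twopiZ.

HB.instance Definition _ := GRing.Zmodule.on angle.

(* e ^ (i a); independent of the representative by expi_pi. *)
Definition expi (a : angle) : R[i] := Complex (cos (repr a)) (sin (repr a)).

End Angle.

(* Both orientations of an edge are elements of [edge], exchanged by [bar].
   Types of vertices and edges are finite: only finite graphs are modelled. *)
Record graph := Graph {
  vertex : finType;
  edge : finType;
  bd : edge -> vertex * vertex;
  bar : edge -> edge;
  barK : involutive bar;
  bar_neq : forall e, bar e != e;
  bd_bar : forall e, bd (bar e) = ((bd e).2, (bd e).1)
}.

Definition src (G : graph) (e : edge G) : vertex G := (bd e).1.
Definition tgt (G : graph) (e : edge G) : vertex G := (bd e).2.

Definition edges_at (G : graph) (v : vertex G) : {set edge G} :=
  [set e | src e == v].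

Definition deg (G : graph) (v : vertex G) : nat := #|edges_at v|.

Section MagneticGraphs.
Variables (R : realType) (S : zmodClosed (angle R)).

(* Graph with a magnetic potential valued in the subgroup S of R / 2 pi Z. *)
Record mgraph := MGraph {
  graph_of :> graph;
  pot : edge graph_of -> angle R;
  pot_in : forall e, pot e \in S;
  pot_bar : forall e, pot (bar e) = - pot e
}.

Record mwgraph := MWGraph {
  mgraph_of :> mgraph;
  wv : vertex mgraph_of -> R;
  we : edge mgraph_of -> R;
  wv_gt0 : forall v, 0 < wv v;
  we_gt0 : forall e, 0 < we e;
  we_bar : forall e, we (bar e) = we e
}.

Definition combinatorial (G : mwgraph) : Prop :=
  (forall v : vertex G, wv v = 1) /\ (forall e : edge G, we e = 1).

Definition standard (G : mwgraph) : Prop :=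
  (forall v : vertex G, wv v = (deg v)%:R) /\ (forall e : edge G, we e = 1).

Definition mw_le (G G' : mwgraph) : Prop :=
  exists (piV : vertex G -> vertex G') (piE : edge G -> edge G'),
  [/\ forall e, bd (piE e) = (piV (src e), piV (tgt e)),
      forall e, pot e = pot (piE e),
      forall v', wv v' <= \sum_(v | piV v == v') wv v
    & forall e', \sum_(e | piE e == e') we e <= we e'].

Section Laplacian.
Variable G : mwgraph.

Definition laplacian (phi : vertex G -> R[i]) (v : vertex G) : R[i] :=
  (real_complex R (wv v))^-1 *
  \sum_(e in edges_at v)
     real_complex R (we e) * (phi v - expi (pot e) * phi (tgt e)).

(* Row i holds the coordinates of the image of the i-th indicator function, so
   that the matrix acts on row vectors, as usual in MathComp. *)
Definition laplacian_mx : 'M[R[i]]_#|vertex G| :=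
  \matrix_(i, j) laplacian (fun v => (v == enum_val i)%:R) (enum_val j).

(* All eigenvalues with multiplicity, in nondecreasing order; see
   char_poly_laplacian_mx for the fact that taking real parts is harmless. *)
Definition eigenvalues : seq R :=
  sort <=%R [seq complex.Re z |
    z <- sval (closed_field_poly_normal (char_poly laplacian_mx))].

(* Numbered from 1; junk unless 1 <= k <= #|vertex G|. *)
Definition lambda (k : nat) : R := nth 0 eigenvalues k.-1.

End Laplacian.

(* The truncated subtraction is harmless: for r > #|vertex G'| both conditions
   hold trivially, as they do over the integers. *)
Definition spectral_le (r : nat) (G G' : mwgraph) : Prop :=
  (#|vertex G'| - r <= #|vertex G|)%N /\
  (forall k : nat, (1 <= k <= #|vertex G'| - r)%N ->
     lambda G k <= lambda G' (k + r)).

End MagneticGraphs.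

Section Contraction.
Variables (G : graph) (v1 v2 : vertex G).

Definition contract_rel (x y : vertex G) : bool :=
  (x == y) || ((x \in [set v1; v2]) && (y \in [set v1; v2])).

Fact contract_rel_equiv : equiv_class_of contract_rel.
Proof.
split=> [x | x y | y x z]; rewrite /contract_rel ?eqxx //.
  by rewrite eq_sym andbC.
case/predU1P=> [-> // | /andP[hx hy]]; case/predU1P=> [<-|/andP[_ hz]].
  by rewrite hx hy orbT.
by rewrite hx hz orbT.
Qed.

Canonical contract_equiv := EquivRelPack contract_rel_equiv.

Definition contract_vertex := {eq_quot contract_equiv}.

HB.instance Definition _ := EqQuotient.on contract_vertex.
HB.instance Definition _ := Countable.on contract_vertex.
HB.instance Definition _ : isFinite contract_vertex :=
  CanIsFinite (@reprK _ contract_vertex).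

Lemma eq_pi_contract (x y : vertex G) :
  (\pi_contract_vertex x == \pi_contract_vertex y) = contract_rel x y.
Proof. by rewrite eqmodE. Qed.

Definition contract_bd (e : edge G) : contract_vertex * contract_vertex :=
  (\pi_contract_vertex (src e), \pi_contract_vertex (tgt e)).

Fact contract_bd_bar e :
  contract_bd (bar e) = ((contract_bd e).2, (contract_bd e).1).
Proof. by rewrite /contract_bd /src /tgt bd_bar. Qed.

Definition contract_graph : graph :=
  Graph (@barK G) (@bar_neq G) contract_bd_bar.

End Contraction.

Definition contract (R : realType) (S : zmodClosed (angle R)) (G : mgraph S)
    (v1 v2 : vertex G) : mgraph S :=
  @MGraph R S (contract_graph v1 v2) (@pot R S G) (@pot_in R S G)
    (@pot_bar R S G).

Section SpectrumTheory.
Variable R : realType.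

Lemma expi_pi (x : R) : expi (\pi_(angle R) x) = Complex (cos x) (sin x).
Proof.
set y := repr (\pi_(angle R) x).
have : (y - x) \in @twopiZ R.
  by rewrite (Quotient.idealrBE (@twopiZ R)) reprK.
rewrite inE => /intrP[m hm].
have pi2 : 2 * pi != 0 :> R by rewrite mulf_neq0 ?pnatr_eq0 ?gt_eqF ?pi_gt0.
have ->: expi (\pi_(angle R) x) = Complex (cos y) (sin y) by [].
have yE : y = x + (pi *+ 2) *~ m.
  move/(canRL (divfK pi2)): hm => /(canRL (subrK _)) ->.
  by rewrite addrC mulr_natl mulrzl.
have per (f : R -> R) : periodic f (pi *+ 2) -> f y = f x.
  move=> pf; rewrite yE; case: (m) => n; first exact: periodicn.
  by rewrite NegzE mulrNz -[LHS](periodicn pf n.+1) subrK.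
by rewrite !per //; [exact: sinD2pi | exact: cosD2pi].
Qed.

Lemma expiN (a : angle R) : expi (- a) = (expi a)^*%C.
Proof.
rewrite -[in LHS](reprK a).
have ->: - \pi_(angle R) (repr a) = \pi_(angle R) (- repr a) by rewrite piE.
by rewrite expi_pi cosN sinN.
Qed.

Variables (S : zmodClosed (angle R)) (G : mwgraph S).

Lemma mul_laplacian_mx (v : 'rV_#|vertex G|) j :
  (v *m laplacian_mx G) 0 j =
  laplacian (fun x : vertex G => v 0 (enum_rank x)) (enum_val j).
Proof.
rewrite mxE /laplacian; under eq_bigr do rewrite mxE /laplacian mulrCA mulr_sumr.
rewrite -mulr_sumr exchange_big /=; congr (_ * _); apply: eq_bigr => e _.
under eq_bigr do rewrite mulrCA; rewrite -mulr_sumr; congr (_ * _).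
have sumE (x : vertex G) :
    \sum_k v 0 k * (x == enum_val k)%:R = v 0 (enum_rank x).
  rewrite (bigD1 (enum_rank x)) //= enum_rankK eqxx mulr1 big1 ?addr0 // => k.
  by rewrite -(inj_eq enum_val_inj) enum_rankK eq_sym => /negPf ->; rewrite mulr0.
under eq_bigr do rewrite mulrBr mulrCA.
by rewrite sumrB -mulr_sumr !sumE.
Qed.

Local Notation "x %:C" := (real_complex R x).

Lemma laplacian_eigenvalue_real z :
  root (char_poly (laplacian_mx G)) z -> z = (complex.Re z)%:C.
Proof.
rewrite -eigenvalue_root_char => /eigenvalueP[v vE vn0].
pose phi (x : vertex G) := v 0 (enum_rank x).
have phiE x : laplacian phi x = z * phi x.
  have := mul_laplacian_mx v (enum_rank x).
  by rewrite vE mxE enum_rankK => <-.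
pose N := \sum_x (wv x)%:C * (phi x * (phi x)^*%C).
pose Q := \sum_(e : edge G)
  (we e)%:C * (phi (src e) - expi (pot e) * phi (tgt e)) * (phi (src e))^*%C.
have QN : Q = z * N.
  rewrite /Q /N mulr_sumr (partition_big (@src G) predT) //=.
  apply: eq_bigr => x _; rewrite [RHS]mulrCA [z * _]mulrA -phiE /laplacian.
  rewrite !mulrA mulfV ?mul1r ?mulr_suml.
    by apply: eq_big => [e | e /eqP <-]; rewrite ?inE //.
  by rewrite eq_complex /= eqxx andbT gt_eqF ?wv_gt0.
have conjM (x y : R[i]) : (x * y)^*%C = x^*%C * y^*%C by exact: rmorphM.
have conj_sum (I : finType) (F : I -> R[i]) :
    (\sum_i F i)^*%C = \sum_i (F i)^*%C.
  exact: rmorph_sum.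
have Nc : N^*%C = N.
  rewrite /N conj_sum; apply: eq_bigr => x _.
  by rewrite !conjM conjc_real conjcK [_^*%C * _]mulrC.
have Qc : Q^*%C = Q.
  have QE : Q = \sum_(e : edge G) (we e)%:C * (phi (src e) * (phi (src e))^*%C)
     - \sum_(e : edge G)
         (we e)%:C * (expi (pot e) * phi (tgt e) * (phi (src e))^*%C).
    by rewrite -sumrB; apply: eq_bigr => e _; rewrite -mulrA mulrBl mulrBr.
  rewrite QE [LHS]rmorphB /= !conj_sum; congr (_ - _).
    apply: eq_bigr => x _.
    by rewrite !conjM conjc_real conjcK [_^*%C * _]mulrC.
  rewrite (reindex_inj (can_inj (@barK G))); apply: eq_bigr => e _ /=.
  rewrite !conjM conjc_real conjcK we_bar pot_bar expiN conjcK.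
  by rewrite /src /tgt bd_bar /= mulrAC.
have Npos : 0 < N.
  have [x xn0] : exists x, phi x != 0.
    case/rV0Pn: vn0 => i vi; exists (enum_val i).
    by rewrite /phi enum_valK.
  have ge0 y : 0 <= (wv y)%:C * (phi y * (phi y)^*%C).
    apply: mulr_ge0; last exact: mul_conjC_ge0.
    by rewrite lecR ltW ?wv_gt0.
  rewrite /N (bigD1 x) //= ltr_pwDl ?sumr_ge0 //.
  by rewrite mulr_gt0 ?mul_conjC_gt0 // ltcR wv_gt0.
have zc : z^*%C = z.
  apply: (mulIf (lt0r_neq0 Npos)).
  by rewrite -QN -[in LHS]Nc -conjM -QN Qc.
by rewrite ReJ_add zc -mulr2n -[z *+ 2]mulr_natr mulfK ?pnatr_eq0.
Qed.

(* [eigenvalues G] is the full real spectrum, with multiplicities. *)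
Lemma char_poly_laplacian_mx :
  char_poly (laplacian_mx G) =
  \prod_(x <- eigenvalues G) ('X - (real_complex R x)%:P).
Proof.
rewrite /eigenvalues; case: closed_field_poly_normal => s /= sE.
rewrite (perm_big _ (permEl (perm_sort _ _))) big_map.
rewrite (monicP (char_poly_monic _)) scale1r in sE.
rewrite {1}sE; apply: eq_big_seq => z zs.
by rewrite -laplacian_eigenvalue_real // sE root_prod_XsubC.
Qed.

Lemma size_eigenvalues : size (eigenvalues G) = #|vertex G|.
Proof.
apply: succn_inj; rewrite -(size_char_poly (laplacian_mx G)).
by rewrite char_poly_laplacian_mx size_prod_XsubC.
Qed.

End SpectrumTheory.

(* Main.v *)
Require Import Defs.
From mathcomp Require Import all_boot all_order all_algebra.
From mathcomp Require Import perm spectral sesquilinear.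
From mathcomp Require Import generic_quotient ring_quotient.
From mathcomp Require Import reals trigo complex.
From mathcomp Require Import zify.
Import Order.TTheory GRing.Theory Num.Theory.

Set Implicit Arguments.
Unset Strict Implicit.
Unset Printing Implicit Defensive.

Local Open Scope ring_scope.
Local Open Scope quotient_scope.

(** Everything follows from the variational characterization of eigenvalues.
    Twice the quadratic form of the magnetic Laplacian is the energy, the sum
    over all oriented edges e of w_e |phi(src e) - exp(i alpha_e)
    phi(tgt e)|^2, while the norm is the mass, the sum of w(v) |phi(v)|^2. The
    Laplacian is similar, through the square roots of the vertex weights, to a
    Hermitian matrix, so in suitable coordinates y of phi the mass is the sum of
    the |y_i|^2 and the energy twice the sum of the lambda_i |y_i|^2
    ([laplacian_diagonalization]).

    Suppose that functions z from a space of dimension p, subject to c linear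
    constraints, can be mapped linearly to functions A z on G' and B z on G,
    with A injective, such that passing from A z to B z does not decrease the
    mass and does not increase the energy. Asking moreover that A z only
    involves the eigenvalues of G' up to the (k+r)-th and B z those of G from
    the k-th on costs |G'| - (k+r) + (k-1) further equations. If |G'| + c is at
    most p + r, a nonzero z survives, and comparing its energy with its mass on
    both sides gives lambda_k(G) <= lambda_(k+r)(G') ([spectral_le_test]).

    All four spectral inequalities are instances, where z ranges over the
    functions on the contracted graph, so that p = |G| - 1.
    - Pulling z back along the projection V -> V/~ preserves the energy. It does
      not decrease the mass, since the weight of a contracted vertex is at most
      the total weight of its fibre; this gives the relation from G to its
      contraction with r = 0.
    - When weights of fibres add up, as degrees do, the pullback also preserves
      the mass, and it is injective with image of codimension 1; this gives the
      converse relation with r = 1.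
    - For combinatorial weights let u be the one of v1, v2 with the smaller
      degree and u' the other one. Pull z back and set the result to 0 at u:
      this preserves the mass. The energy can only be too large on the edges at
      u, and one constraint per such edge makes it vanish there for z. The s
      edges from u to u' without magnetic potential become loops on which it
      vanishes anyway, so deg(u) - s constraints suffice.

    The projection, together with the identity of the edges, is moreover an
    MW-homomorphism, again because weights of fibres are large enough. *)

(** * Linear algebra *)

Local Notation "M ^t*" := (map_mx Num.conj (trmx M)) (at level 30).

Lemma linear_system_nontrivial (F : fieldType) p c (M : 'M[F]_(p, c)) :
  (c < p)%N -> exists2 z : 'rV_p, z != 0 & z *m M = 0.
Proof.
move=> lt_cp; have /rowV0Pn[z /sub_kermxP zM z0] : kermx M != 0.
  rewrite -mxrank_eq0 mxrank_ker subn_eq0 -ltnNge.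
  exact: leq_ltn_trans (rank_leq_col M) lt_cp.
by exists z.
Qed.

Lemma char_poly_similar (F : fieldType) n (P A B : 'M[F]_n) :
  P \in unitmx -> P *m A = B *m P -> char_poly A = char_poly B.
Proof.
move=> Pu PA; pose Q := map_mx (@polyC F) P.
have Qu : \det Q != 0 by rewrite det_map_mx polyC_eq0 -unitfE -unitmxE.
apply: (mulfI Qu); rewrite [RHS]mulrC /char_poly -!det_mulmx /char_poly_mx.
by rewrite mulmxBr mulmxBl scalar_mxC -!map_mxM PA.
Qed.

Section HermitianForms.
Variable C : numClosedFieldType.

Lemma diag_form n (d z : 'rV[C]_n) :
  (z *m diag_mx d *m z ^t*) 0 0 = \sum_i d 0 i * `|z 0 i| ^+ 2.
Proof.
rewrite mxE; apply: eq_bigr => i _.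
by rewrite mul_mx_diag !mxE normCK mulrAC [RHS]mulrC mulrAC.
Qed.

(** The spectral theorem provides the eigenvalues in an unspecified order; the
    prescribed order [s] is restored by a permutation [g] of the coordinates,
    as two factorizations of the characteristic polynomial agree up to order. *)
Lemma hermitian_diag n (H : 'M[C]_n) (s : seq C) :
  H \is hermsymmx -> char_poly H = \prod_(x <- s) ('X - x%:P) ->
  exists U : 'M[C]_n, forall z : 'rV_n,
    (z *m z ^t*) 0 0 = \sum_(i < n) `|(z *m U) 0 i| ^+ 2 /\
    (z *m H *m z ^t*) 0 0 = \sum_(i < n) s`_i * `|(z *m U) 0 i| ^+ 2.
Proof.
move=> /hermitian_normalmx/orthomx_spectralP HE Hs.
set P := spectralmx H in HE; set sp := spectral_diag H in HE.
have Pun : P \is unitarymx := spectral_unitarymx H.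
have Pu : P \in unitmx := unitarymx_unit Pun.
have sp_s : perm_eq [tuple sp 0 i | i < n] s.
  apply: prod_XsubC_eq; rewrite -Hs big_map big_enum /=.
  have -> : char_poly H = char_poly (diag_mx sp).
    apply: (char_poly_similar Pu).
    by rewrite [in LHS]HE -mulmxA [P *m (_ *m _)]mulKVmx.
  rewrite char_poly_trig; last by rewrite diag_mx_is_trig.
  by apply: eq_bigr => i _; rewrite mxE eqxx mulr1n.
have /tuple_permP[g gE] : perm_eq s [tuple sp 0 i | i < n] by rewrite perm_sym.
have sE (i : 'I_n) : s`_i = sp 0 (g i).
  by rewrite gE -tnth_nth !tnth_mktuple.
exists (col_perm g (invmx P)) => z.
have zE i : (z *m col_perm g (invmx P)) 0 i = (z *m invmx P) 0 (g i).
  by rewrite !mxE; apply: eq_bigr => j _; rewrite mxE.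
have yE : (z *m invmx P)^t* = P *m z^t*.
  by rewrite trmx_mul map_mxM invmx_unitary // trmxCK.
split.
  have -> : z *m z ^t* =
      (z *m invmx P) *m diag_mx (const_mx 1) *m (z *m invmx P)^t*.
    by rewrite diag_const_mx mulmx1 yE mulmxA mulmxKV.
  rewrite diag_form (reindex_perm g); apply: eq_bigr => i _.
  by rewrite zE mxE mul1r.
have -> : z *m H *m z ^t* = (z *m invmx P) *m diag_mx sp *m (z *m invmx P)^t*.
  by rewrite yE [in LHS]HE !mulmxA.
rewrite diag_form (reindex_perm g); apply: eq_bigr => i _.
by rewrite zE sE.
Qed.
End HermitianForms.

(** * Energy, mass and the spectrum of a magnetic graph *)

Section Forms.
Variables (R : realType) (S : zmodClosed (angle R)).
Local Notation C := R[i].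
Local Notation "x %:C" := (real_complex R x).

Lemma conj_real (x : R) : Num.conj x%:C = x%:C :> C.
Proof. exact: conjc_real. Qed.

Lemma expi_bar (G : mwgraph S) (e : edge G) :
  expi (pot (bar e)) = Num.conj (expi (pot e)) :> C.
Proof. by rewrite pot_bar expiN. Qed.

Lemma expi_norm (a : angle R) : `|expi a| = 1 :> C.
Proof. by rewrite normc_def /= cos2Dsin2 sqrtr1. Qed.

Lemma expi0 : expi (0 : angle R) = 1 :> C.
Proof.
have -> : (0 : angle R) = \pi_(angle R) 0 by rewrite piE.
by rewrite expi_pi cos0 sin0.
Qed.

Definition vfun (T : finType) (z : 'rV[C]_#|T|) (x : T) : C :=
  z 0 (enum_rank x).

Lemma vfunE (T : finType) (z : 'rV[C]_#|T|) i : vfun z (enum_val i) = z 0 i.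
Proof. by rewrite /vfun enum_valK. Qed.

Lemma vfunB (T : finType) (y z : 'rV[C]_#|T|) x :
  vfun (y - z) x = vfun y x - vfun z x.
Proof. by rewrite /vfun !mxE. Qed.

Section OneGraph.
Variable G : mwgraph S.
Implicit Types (e : edge G) (x y : vertex G) (phi : vertex G -> C).

Definition mass phi : C := \sum_x (wv x)%:C * `|phi x| ^+ 2.

(** Failure of [phi] to be parallel along [e]; reversing [e] only changes it
    by a phase. *)
Definition defect phi e : C := phi (src e) - expi (pot e) * phi (tgt e).

Definition energy phi : C := \sum_e (we e)%:C * `|defect phi e| ^+ 2.

Lemma src_bar e : src (bar e) = tgt e.
Proof. by rewrite /src bd_bar. Qed.

Lemma tgt_bar e : tgt (bar e) = src e.
Proof. by rewrite /tgt bd_bar. Qed.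

Lemma sum_bar (F : edge G -> C) : \sum_e F e = \sum_e F (bar e).
Proof. exact: (reindex_inj (can_inj (@barK G))). Qed.

Lemma defect_bar phi e :
  defect phi (bar e) = - (Num.conj (expi (pot e)) * defect phi e).
Proof.
rewrite /defect src_bar tgt_bar expi_bar mulrBr mulrA opprB.
by rewrite [_^* * expi _]mulrC -normCK expi_norm expr1n mul1r.
Qed.

Lemma sum_vertices_edges (F : edge G -> C) :
  \sum_e F e = \sum_x \sum_(e in edges_at x) F e.
Proof.
rewrite (partition_big (@src G) predT) //=; apply: eq_bigr => x _.
by apply: eq_bigl => e; rewrite inE.
Qed.

Lemma wv_neq0 x : (wv x)%:C != 0 :> C.
Proof. by rewrite eq_complex /= eqxx andbT gt_eqF ?wv_gt0. Qed.

(** Green's formula. Each edge enters the left-hand side through the conjugate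
    of its whole defect, and the right-hand side only through the part at its
    source; the part at its target is the same expression for the reversed
    edge. *)
Lemma energy_laplacian phi :
  energy phi = 2 * \sum_x (wv x)%:C * laplacian phi x * Num.conj (phi x).
Proof.
have -> : \sum_x (wv x)%:C * laplacian phi x * Num.conj (phi x) =
    \sum_e (we e)%:C * defect phi e * Num.conj (phi (src e)).
  rewrite sum_vertices_edges; apply: eq_bigr => x _.
  rewrite /laplacian mulrA mulfV ?wv_neq0 // mul1r mulr_suml.
  by apply: eq_bigr => e /[!inE]/eqP <-.
rewrite mulr_natl mulr2n [X in _ + X]sum_bar -big_split /=.
apply: eq_bigr => e _.
rewrite we_bar defect_bar src_bar -!mulrA -mulrDr normCK; congr (_ * _).
rewrite {3}/defect rmorphB rmorphM /= mulrBr mulNr; congr (_ - _).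
by rewrite mulrCA mulrA.
Qed.

Lemma mass_ge0 phi : 0 <= mass phi.
Proof.
by apply: sumr_ge0 => x _; rewrite mulr_ge0 ?exprn_ge0 // lecR ltW ?wv_gt0.
Qed.

Lemma energy_ge0 phi : 0 <= energy phi.
Proof.
by apply: sumr_ge0 => e _; rewrite mulr_ge0 ?exprn_ge0 // lecR ltW ?we_gt0.
Qed.

Lemma mass_eq0 phi : mass phi = 0 -> forall x, phi x = 0.
Proof.
move=> /eqP; rewrite psumr_eq0 => [/allP m0 x|x _]; last first.
  by rewrite mulr_ge0 ?exprn_ge0 // lecR ltW ?wv_gt0.
have := m0 x (mem_index_enum x); rewrite mulf_eq0 (negPf (wv_neq0 x)) /=.
by rewrite expf_eq0 normr_eq0 => /eqP.
Qed.

(** The coefficients of the Hermitian form of the Laplacian on indicator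
    functions; the matrix of the Laplacian itself is not Hermitian because it
    carries a factor 1 / w(y). *)
Definition form_coef x y : C :=
  \sum_(e in edges_at y)
    (we e)%:C * ((y == x)%:R - expi (pot e) * (tgt e == x)%:R).

Lemma form_coef_conj x y : Num.conj (form_coef y x) = form_coef x y.
Proof.
have cE a b : form_coef a b =
    \sum_(e in edges_at b) (we e)%:C * (b == a)%:R
    - \sum_e (we e)%:C * expi (pot e)
        * ((tgt e == a) && (src e == b))%:R.
  rewrite [X in _ - X]sum_vertices_edges (bigD1 b) //= [X in _ - (_ + X)]big1.
    rewrite addr0 -sumrB; apply: eq_bigr => e /[!inE] ->.
    by rewrite andbT mulrBr mulrA.
  move=> c /negPf cb; apply: big1 => e /[!inE]/eqP ->.
  by rewrite cb andbF mulr0.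
rewrite !cE rmorphB !rmorph_sum /=; congr (_ - _).
  have [->|_] := eqVneq x y.
    by apply: eq_bigr => e _; rewrite rmorphM /= conj_real rmorph_nat.
  rewrite 2?big1 // => e _; first by rewrite mulr0.
  by rewrite rmorphM rmorph_nat mulr0.
rewrite sum_bar; apply: eq_bigr => e _.
rewrite !rmorphM /= rmorph_nat conj_real we_bar expi_bar conjCK.
by rewrite src_bar tgt_bar andbC.
Qed.

Let d : 'rV[C]_#|vertex G| := \row_i (Num.sqrt (wv (enum_val i)))%:C.

Lemma sqrt_weight_neq0 i : d 0 i != 0.
Proof. by rewrite mxE eq_complex /= eqxx andbT gt_eqF // sqrtr_gt0 wv_gt0. Qed.

(** With D the diagonal matrix of the square roots of the vertex weights, D^-1
    L D is Hermitian for the matrix L of the Laplacian, and a unitary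
    diagonalization U of it yields the coordinates z D U. *)
Lemma laplacian_diagonalization :
  exists P : 'M[C]_#|vertex G|, forall z : 'rV_#|vertex G|,
    mass (vfun z) = \sum_(i < #|vertex G|) `|(z *m P) 0 i| ^+ 2 /\
    energy (vfun z) =
      2 * \sum_(i < #|vertex G|) (lambda G i.+1)%:C * `|(z *m P) 0 i| ^+ 2.
Proof.
pose D := diag_mx d; pose D' := diag_mx (\row_i (d 0 i)^-1).
have DD' : D *m D' = 1%:M.
  rewrite mulmx_diag -diag_const_mx; congr diag_mx; apply/rowP=> i.
  by rewrite mxE [in X in _ * X]mxE [RHS]mxE mulfV ?sqrt_weight_neq0.
have [Du _] := mulmx1_unit DD'.
have Dc : D ^t* = D.
  rewrite tr_diag_mx map_diag_mx; congr diag_mx.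
  by apply/rowP=> i; rewrite !mxE /= conj_real.
have dd i : d 0 i * d 0 i = (wv (enum_val i))%:C.
  by rewrite !mxE -rmorphM /= -expr2 sqr_sqrtr // ltW ?wv_gt0.
pose L := laplacian_mx G; pose H := D' *m L *m D.
have HL : char_poly H =
    \prod_(x <- map (real_complex R) (eigenvalues G)) ('X - x%:P).
  rewrite big_map -char_poly_laplacian_mx.
  by apply: (char_poly_similar Du); rewrite /H !mulmxA DD' mul1mx.
have HE i j : H i j =
    (d 0 i)^-1 * (d 0 j)^-1 * form_coef (enum_val i) (enum_val j).
  rewrite /H mul_mx_diag mxE mul_diag_mx mxE [L i j]mxE /laplacian mxE.
  rewrite -dd invfM -!mulrA; do 2! congr (_ * _).
  by rewrite mulrA mulrAC mulVf ?sqrt_weight_neq0 // mul1r.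
have Hh : H \is hermsymmx.
  apply/is_hermitianmxP; rewrite expr0 scale1r; apply/matrixP=> i j.
  rewrite [RHS]mxE [in RHS]mxE !HE !rmorphM !fmorphV /= form_coef_conj.
  by rewrite !mxE !conj_real [in RHS](mulrC _^-1).
have [U UE] := hermitian_diag Hh HL.
exists (D *m U) => z; have := UE (z *m D); rewrite !mulmxA => -[<- zH].
have zDt : (z *m D)^t* = D *m z^t* by rewrite trmx_mul map_mxM Dc.
split.
  rewrite zDt /mass mulmxA -(mulmxA z) mulmx_diag diag_form.
  rewrite (reindex _ (onW_bij _ (@enum_val_bij (vertex G)))) /=.
  by apply: eq_bigr => i _; rewrite vfunE mxE dd.
rewrite energy_laplacian; congr (_ * _).
have lE (i : 'I_#|vertex G|) :
    (map (real_complex R) (eigenvalues G))`_i = (lambda G i.+1)%:C.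
  by rewrite (nth_map 0) // size_eigenvalues.
under [RHS]eq_bigr do rewrite -lE.
rewrite -zH zDt /H !mulmxA.
rewrite -(mulmxA z D D') DD' mulmx1 -(mulmxA (z *m L)) mulmx_diag mul_mx_diag.
rewrite mxE (reindex _ (onW_bij _ (@enum_val_bij (vertex G)))) /=.
apply: eq_bigr => i _.
rewrite vfunE !mxE.
have -> : laplacian (vfun z) (enum_val i) = (z *m L) 0 i.
  by rewrite mul_laplacian_mx.
by rewrite -dd !mxE; congr (_ * _); rewrite mulrC.
Qed.

Lemma lambda_le i j : (0 < i <= j)%N -> (j <= #|vertex G|)%N ->
  lambda G i <= lambda G j.
Proof.
move=> /andP[i0 ij] jn; rewrite /lambda.
have := size_eigenvalues G; set s := eigenvalues G => sz.
have ss : sorted <=%R s by apply: sort_le_sorted.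
have lt k : (0 < k <= #|vertex G|)%N -> k.-1 \in [pred k | (k < size s)%N].
  by case: k => // k; rewrite inE sz.
apply: (sorted_leq_nth le_trans le_refl 0 ss).
- by rewrite lt // i0 (leq_trans ij).
- by rewrite lt // jn (leq_trans i0).
- by rewrite -!subn1 leq_sub2r.
Qed.

End OneGraph.

(** * The variational comparison principle *)

(** The Courant-Fischer principle in a form that compares two graphs without
    mentioning subspaces: a nonzero solution of a system with fewer equations
    than unknowns replaces the intersection of two subspaces. The bound on the
    number of vertices comes out of the same count, as [B] is injective where
    [U] vanishes. *)
Lemma spectral_le_test (G G' : mwgraph S) p c r
    (A : 'M[C]_(p, #|vertex G'|)) (B : 'M[C]_(p, #|vertex G|))
    (U : 'M[C]_(p, c)) :
  (#|vertex G'| + c <= p + r)%N ->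
  (forall z : 'rV_p, z *m U = 0 -> z *m A = 0 -> z = 0) ->
  (forall z : 'rV_p, z *m U = 0 ->
     mass (vfun (z *m A)) <= mass (vfun (z *m B))) ->
  (forall z : 'rV_p, z *m U = 0 ->
     energy (vfun (z *m B)) <= energy (vfun (z *m A))) ->
  spectral_le r G G'.
Proof.
move=> dim_p A_inj mass_le energy_le.
have mass_gt0 z : z != 0 -> z *m U = 0 -> 0 < mass (vfun (z *m A)).
  move=> z0 zU; rewrite lt_neqAle mass_ge0 andbT eq_sym.
  apply: contra z0 => /eqP/mass_eq0 zA; apply/eqP/A_inj => //.
  by apply/rowP=> i; rewrite -vfunE zA mxE.
have le_size : (#|vertex G'| - r <= #|vertex G|)%N.
  rewrite leqNgt; apply/negP => lt_size.
  have [|z z0] := @linear_system_nontrivial _ _ _ (row_mx U B).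
    move: lt_size dim_p; set a := #|vertex G'|; set b := #|vertex G|; lia.
  rewrite mul_mx_row => /eqP; rewrite row_mx_eq0 => /andP[/eqP zU /eqP zB].
  have := lt_le_trans (mass_gt0 z z0 zU) (mass_le z zU).
  rewrite /mass big1 ?ltxx // => x _.
  by rewrite zB /vfun mxE normr0 expr0n mulr0.
split=> // k /andP[k_gt0 k_le].
rewrite leNgt; apply/negP => lt_lambda.
have [P PE] := laplacian_diagonalization G.
have [P' PE'] := laplacian_diagonalization G'.
have lek : (k.-1 <= #|vertex G|)%N.
  by rewrite (leq_trans (leq_pred k)) ?(leq_trans k_le).
have lek' : (k + r <= #|vertex G'|)%N.
  by move: k_gt0 k_le; set a := #|vertex G'|; lia.
(* Coordinates are numbered from 0 and eigenvalues from 1: [low] selects the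
   eigenvalues before the k-th one, [high] those after the (k+r)-th one. *)
pose low (i : 'I_k.-1) := widen_ord lek i.
pose high (i : 'I_(#|vertex G'| - (k + r))) :=
  cast_ord (subnKC lek') (rshift (k + r) i).
have [|z z0] := @linear_system_nontrivial _ _ _
    (row_mx U (row_mx (colsub low (B *m P)) (colsub high (A *m P')))).
  by move: k_gt0 k_le dim_p; set a := #|vertex G'|; lia.
rewrite !mul_mx_row => /eqP; rewrite !row_mx_eq0.
case/and3P=> /eqP zU /eqP zlow /eqP zhigh.
have lowE (i : 'I_#|vertex G|) : (i < k.-1)%N -> (z *m B *m P) 0 i = 0.
  move=> ik; have /rowP/(_ (Ordinal ik)) := zlow.
  rewrite -mulmxA !mxE => zE; rewrite -[RHS]zE; apply: eq_bigr => j _.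
  by rewrite [in RHS]mxE; congr (_ * (B *m P) _ _); apply: val_inj.
have highE (i : 'I_#|vertex G'|) : (k + r <= i)%N -> (z *m A *m P') 0 i = 0.
  move=> ki; have ik : (i - (k + r) < #|vertex G'| - (k + r))%N.
    by rewrite ltn_sub2r // (leq_ltn_trans ki).
  have /rowP/(_ (Ordinal ik)) := zhigh.
  rewrite -mulmxA !mxE => zE; rewrite -[RHS]zE; apply: eq_bigr => j _.
  rewrite [in RHS]mxE; congr (_ * (A *m P') _ _); apply: val_inj => /=.
  by rewrite subnKC.
have [mB eB] := PE (z *m B); have [mA eA] := PE' (z *m A).
have two0 : (0 : C) < 2 by rewrite ltr0n.
have loE :
    2 * ((lambda G k)%:C * mass (vfun (z *m B))) <= energy (vfun (z *m B)).
  rewrite eB mB ler_pM2l // mulr_sumr; apply: ler_sum => i _.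
  have [ik|ki] := ltnP i k.-1; first by rewrite lowE // normr0 expr0n !mulr0.
  rewrite ler_wpM2r ?exprn_ge0 // lecR lambda_le //.
  by rewrite k_gt0 -(prednK k_gt0) ltnS.
have hiE : energy (vfun (z *m A)) <=
    2 * ((lambda G' (k + r))%:C * mass (vfun (z *m A))).
  rewrite eA mA ler_pM2l // mulr_sumr; apply: ler_sum => i _.
  have [ki|ik] := leqP (k + r) i.
    by rewrite highE // normr0 expr0n !mulr0.
  by rewrite ler_wpM2r ?exprn_ge0 // lecR lambda_le.
have m_gt0 := mass_gt0 z z0 zU.
(* The eigenvalue of [G] multiplies a mass that may grow from [A] to [B], so
   its sign matters. *)
have l'_ge0 : 0 <= lambda G' (k + r).
  have := le_trans (energy_ge0 _) hiE.
  by rewrite pmulr_rge0 // pmulr_lge0 // ler0c.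
have l_gt0 : 0 < lambda G k := le_lt_trans l'_ge0 lt_lambda.
have := le_trans (le_trans loE (energy_le z zU)) hiE.
rewrite ler_pM2l // => le_energy.
have lt_mass : (lambda G' (k + r))%:C * mass (vfun (z *m A)) <
    (lambda G k)%:C * mass (vfun (z *m A)).
  by rewrite ltr_pM2r // ltcR.
have le_mass : (lambda G k)%:C * mass (vfun (z *m A)) <=
    (lambda G k)%:C * mass (vfun (z *m B)).
  by rewrite ler_wpM2l ?mass_le // ler0c ltW.
by have := lt_le_trans lt_mass (le_trans le_mass le_energy); rewrite ltxx.
Qed.

(** Matrix of the weighted composition operator; see [vfun_wpull]. *)
Definition wpull (T T' : finType) (a : T -> C) (f : T -> T') :
    'M[C]_(#|T'|, #|T|) :=
  \matrix_(i, j) (a (enum_val j) * (enum_val i == f (enum_val j))%:R).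

Lemma vfun_wpull (T T' : finType) (a : T -> C) (f : T -> T') z x :
  vfun (z *m wpull a f) x = a x * vfun z (f x).
Proof.
rewrite /vfun mxE (bigD1 (enum_rank (f x))) //= big1 ?addr0 => [|i i_fx].
  by rewrite mxE !enum_rankK eqxx mulr1 mulrC.
rewrite mxE enum_rankK -(inj_eq enum_rank_inj) enum_valK (negPf i_fx).
by rewrite !mulr0.
Qed.

(** * Contracting two vertices *)

Section Contraction.
Variables (G : mwgraph S) (v1 v2 : vertex G).
Local Notation Vt := (contract_vertex v1 v2).
Variables (wvt : Vt -> R) (wet : edge G -> R).
Hypotheses (wvt_gt0 : forall y, 0 < wvt y) (wet_gt0 : forall e, 0 < wet e).
Hypothesis wet_bar : forall e, wet (bar e) = wet e.

Let Gt : mwgraph S :=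
  @MWGraph R S (contract v1 v2) wvt wet wvt_gt0 wet_gt0 wet_bar.

Definition proj (x : vertex G) : vertex Gt := \pi_(contract_vertex v1 v2) x.

Lemma proj_repr y : proj (repr y) = y.
Proof. exact: reprK. Qed.

Lemma eq_proj x y : (proj x == proj y) = contract_rel v1 v2 x y.
Proof. exact: eq_pi_contract. Qed.

Lemma mw_le_contract :
  (forall y, wvt y <= \sum_(x | proj x == y) wv x) -> wet =1 we (m := G) ->
  mw_le G Gt.
Proof.
move=> wvt_le wetE; exists proj, id; split=> // e.
by rewrite big_pred1_eq /= wetE.
Qed.

Lemma energy_proj (phi : vertex Gt -> C) (psi : vertex G -> C) :
  wet =1 we (m := G) -> (forall x, psi x = phi (proj x)) ->
  energy psi = energy phi.
Proof.
move=> wetE psiE; apply: eq_bigr => e _.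
by rewrite /= wetE /defect !psiE.
Qed.

Lemma mass_proj (phi : vertex Gt -> C) (psi : vertex G -> C) :
  (forall x, psi x = phi (proj x)) ->
  mass psi = \sum_y (\sum_(x | proj x == y) wv x)%:C * `|phi y| ^+ 2.
Proof.
move=> psiE; rewrite /mass (partition_big proj predT) //=.
apply: eq_bigr => y _; rewrite rmorph_sum /= mulr_suml.
by apply: eq_bigr => x /eqP <-; rewrite psiE.
Qed.

Let pullback : 'M[C]_(#|vertex Gt|, #|vertex G|) := wpull (fun=> 1) proj.

Lemma vfun_pullback z x : vfun (z *m pullback) x = vfun z (proj x).
Proof. by rewrite vfun_wpull mul1r. Qed.

Lemma spectral_le_contract :
  (forall y, wvt y <= \sum_(x | proj x == y) wv x) -> wet =1 we (m := G) ->
  spectral_le 0 G Gt.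
Proof.
move=> wvt_le wetE.
apply: (@spectral_le_test _ _ _ 0 0 1%:M pullback 0) => // z _;
  rewrite mulmx1 //.
  rewrite (mass_proj (vfun_pullback z)); apply: ler_sum => y _.
  by rewrite ler_wpM2r ?exprn_ge0 // lecR.
by rewrite (energy_proj wetE (vfun_pullback z)).
Qed.

Section MovedVertex.
Variables u u' : vertex G.
Hypotheses (u_neq : u != u') (uu' : [set v1; v2] = [set u; u']).

(** Reindexing along this section of the projection turns sums over the
    contracted vertices into sums over the vertices other than [u]. *)
Definition lift_proj (y : vertex Gt) : vertex G :=
  if repr y == u then u' else repr y.

Lemma proj_uu' : proj u = proj u'.
Proof. by apply/eqP; rewrite eq_proj /contract_rel uu' !inE !eqxx !orbT. Qed.

Lemma lift_projK y : proj (lift_proj y) = y.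
Proof.
rewrite /lift_proj; case: eqP => [yu|_]; last exact: proj_repr.
by rewrite -proj_uu' -yu proj_repr.
Qed.

Lemma lift_proj_neq y : lift_proj y != u.
Proof.
by rewrite /lift_proj; case: ifP => [_|/negbT]; first by rewrite eq_sym.
Qed.

Lemma proj_inj x y : x != u -> y != u -> proj x = proj y -> x = y.
Proof.
move=> /negPf xu /negPf yu /eqP; rewrite eq_proj /contract_rel uu' !inE xu yu.
by case/predU1P => // /andP[/eqP -> /eqP ->].
Qed.

Lemma lift_proj_eq x : (lift_proj (proj x) == x) = (x != u).
Proof.
apply/eqP/idP => [<-|xu]; first exact: lift_proj_neq.
by apply: proj_inj; rewrite ?lift_proj_neq ?lift_projK.
Qed.

Lemma sum_contract (V : nmodType) (F : vertex Gt -> V) :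
  \sum_y F y = \sum_(x | x != u) F (proj x).
Proof.
rewrite (reindex_onto proj lift_proj) => [|y _]; last exact: lift_projK.
by apply: eq_bigl => x; rewrite lift_proj_eq.
Qed.

Lemma card_contractS : #|vertex G| = #|vertex Gt|.+1.
Proof.
have := sum_contract (fun=> 1%N); rewrite !sum1_card => ->.
rewrite -[LHS]prednK -?(cardC1 u) //; first by apply/card_gt0P; exists u.
Qed.

Hypotheses (wvE : forall x : vertex G, wv x = 1) (wvtE : forall y, wvt y = 1).
Hypothesis wetE : wet =1 we (m := G).

(** One constraint is spent on each of these edges. The contraction turns the
    other edges leaving [u] into loops without potential, on which the defect of
    any function vanishes. *)
Let loose : pred (edge G) :=
  fun e => (src e == u) && ~~ ((tgt e == u') && (pot e == 0)).
Let loose_edge : finType := {e | loose e}.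

Let gauge : 'M[C]_(#|vertex Gt|, #|loose_edge|) :=
  wpull (fun=> 1) (fun e : loose_edge => proj (src (val e)))
  - wpull (fun e : loose_edge => expi (pot (val e)))
      (fun e : loose_edge => proj (tgt (val e))).

(** An edge ending at [u] is the reverse of one starting there, so it needs no
    constraint of its own. *)
Lemma gauge_defect z (e : edge Gt) : z *m gauge = 0 ->
  (src (e : edge G) == u) || (tgt (e : edge G) == u) -> defect (vfun z) e = 0.
Proof.
move=> zU.
have srcu (f : edge Gt) : src (f : edge G) == u -> defect (vfun z) f = 0.
  move=> fu; have [ff|] := boolP (loose f).
    have : vfun (z *m gauge) (exist _ f ff) = 0 by rewrite zU /vfun mxE.
    by rewrite mulmxBr vfunB !vfun_wpull mul1r.
  rewrite /loose fu negbK => /andP[/eqP fu' /eqP f0].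
  rewrite /defect.
  have -> : src f = proj (src (f : edge G)) by [].
  have -> : tgt f = proj (tgt (f : edge G)) by [].
  have -> : pot f = pot (f : edge G) by [].
  by rewrite (eqP fu) fu' f0 proj_uu' expi0 mul1r subrr.
case/orP=> [/srcu // | eu].
have /eqP : defect (vfun z) (bar e) = 0 by apply: srcu; rewrite (@src_bar G).
rewrite defect_bar oppr_eq0 mulf_eq0 conjC_eq0 -normr_eq0 expi_norm oner_eq0 /=.
by move/eqP.
Qed.

(** Functions on the contracted graph are extended by 0 to [u]. On [G] the edges
    at [u] then contribute some nonnegative energy, on the contraction none,
    thanks to the [gauge] constraints; all other edges contribute equally. *)
Lemma spectral_le_uncontract_unit :
  spectral_le (deg u + 1 -
    #|[set e : edge G | [&& src e == u, tgt e == u' & pot e == 0%R]]|)%N Gt G.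
Proof.
pose extend : 'M[C]_(#|vertex Gt|, #|vertex G|) :=
  wpull (fun x => (x != u)%:R) proj.
have extE (z : 'rV_#|vertex Gt|) x :
    vfun (z *m extend) x = (x != u)%:R * vfun z (proj x).
  exact: vfun_wpull.
apply: (@spectral_le_test _ _ _ _ _ extend 1%:M gauge) => [|z _ zA|z _|z zU].
- set s := #|_|; have deg_u : deg u = (#|loose_edge| + s)%N.
    rewrite card_sig addnC /deg.
    rewrite -(cardsID [set e | (tgt e == u') && (pot e == 0%R)]).
    congr (_ + _)%N; first by apply: eq_card => e; rewrite !inE.
    by apply: eq_card => e; rewrite !inE andbC.
  rewrite card_contractS deg_u; set a := #|vertex Gt|; set b := #|_|; lia.
- apply/rowP=> i; rewrite -vfunE -[enum_val i]lift_projK.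
  have := extE z (lift_proj (enum_val i)).
  by rewrite zA lift_proj_neq mul1r => <-; rewrite /vfun !mxE.
- rewrite mulmx1 {2}/mass (sum_contract (fun y => _ * `|vfun z y| ^+ 2)).
  rewrite /mass [X in X <= _](bigID (fun x => x != u)) /=.
  rewrite [X in _ + X]big1 ?addr0 => [|x /negbNE/eqP xu].
    by apply: ler_sum => x xu; rewrite extE xu mul1r wvE wvtE.
  by rewrite extE xu eqxx mul0r normr0 expr0n mulr0.
- rewrite mulmx1; apply: ler_sum => e _.
  have [eu|] := boolP ((src (e : edge G) == u) || (tgt (e : edge G) == u)).
    rewrite (gauge_defect zU eu) normr0 expr0n mulr0.
    by rewrite mulr_ge0 ?exprn_ge0 // lecR ltW ?we_gt0.
  rewrite negb_or => /andP[su tu].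
  by rewrite /= wetE {2}/defect !extE su tu !mul1r.
Qed.
End MovedVertex.

(** With additive vertex weights the pullback is an isometry of codimension 1
    that preserves the energy. *)
Lemma spectral_le_uncontract :
  v1 != v2 ->
  (forall y, wvt y = \sum_(x | proj x == y) wv x) -> wet =1 we (m := G) ->
  spectral_le 1 Gt G.
Proof.
move=> v12 wvtE wetE.
apply: (@spectral_le_test _ _ _ 0 1 pullback 1%:M 0) => [|z _ zA|z _|z _].
- by rewrite (card_contractS v12 erefl) addn0 addn1.
- apply/rowP=> i; rewrite -vfunE -[enum_val i]proj_repr -vfun_pullback zA.
  by rewrite /vfun !mxE.
- rewrite (mass_proj (vfun_pullback z)) mulmx1; apply: ler_sum => y _.
  by rewrite /= wvtE.
- by rewrite mulmx1 (energy_proj wetE (vfun_pullback z)).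
Qed.

End Contraction.

Lemma parallel_edges_sym (G : mwgraph S) (u u' : vertex G) :
  #|[set e : edge G | [&& src e == u, tgt e == u' & pot e == 0]]| =
  #|[set e : edge G | [&& src e == u', tgt e == u & pot e == 0]]|.
Proof.
rewrite -(card_preimset _ (can_inj (@barK G))); apply: eq_card => e.
by rewrite !inE src_bar tgt_bar pot_bar oppr_eq0 andbCA.
Qed.

Lemma deg_contract (G : mgraph S) (v1 v2 : vertex G)
    (y : vertex (contract v1 v2)) :
  deg y = (\sum_(x : vertex G | \pi_(contract_vertex v1 v2) x == y) deg x)%N.
Proof.
rewrite /deg -sum1_card.
rewrite (partition_big (@src G)
  (fun x => \pi_(contract_vertex v1 v2) x == y)).
  apply: eq_bigr => x /eqP xy; rewrite sum1_card; apply: eq_card => e.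
  rewrite unfold_in !inE andbC; case: (src e =P x) => //= ex.
  by apply/eqP; rewrite -xy -ex.
by move=> e; rewrite inE.
Qed.
End Forms.

Theorem corollary4p7 (R : realType) (S : zmodClosed (angle R))
    (G Gt : mwgraph S) (v1 v2 : vertex G) (v1_neq_v2 : v1 != v2)
    (Gt_contract : mgraph_of Gt = contract v1 v2) :
  (combinatorial G -> combinatorial Gt ->
     let r := minn (deg v1) (deg v2) in
     let s := #|[set e : edge G |
                  [&& src e == v1, tgt e == v2 & pot e == 0]]| in
     [/\ mw_le G Gt,
         spectral_le (r + 1 - s)%N Gt G
       & spectral_le 0 G Gt]) /\
  (standard G -> standard Gt ->
     [/\ mw_le G Gt,
         spectral_le 1 Gt G
       & spectral_le 0 G Gt]).
Proof.
case: Gt Gt_contract => mg wvt wet wvt0 wet0 wetb /= E; subst mg.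
pose pr := proj wvt0 wet0 wetb.
split.
  move=> [wv1 we1] [wvt1 wet1].
  have wetE : wet =1 we (m := G) by move=> e; rewrite we1; exact: wet1.
  have wvtE y : wvt y <= \sum_(x | pr x == y) wv x.
    have /= -> := wvt1 y.
    rewrite (bigD1 (repr y)) /=; last by rewrite /pr proj_repr.
    by rewrite wv1 lerDl sumr_ge0 // => x _; rewrite ltW ?wv_gt0.
  split; first exact: (mw_le_contract wvtE wetE).
    2: exact: (spectral_le_contract wvtE wetE).
  case: leqP => _; first exact: spectral_le_uncontract_unit.
  rewrite parallel_edges_sym.
  by apply: spectral_le_uncontract_unit; rewrite 1?eq_sym // setUC.
move=> [wvd we1] [wvtd wet1].
have wetE : wet =1 we (m := G) by move=> e; rewrite we1; exact: wet1.
have wvtE y : wvt y = \sum_(x | pr x == y) wv x.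
  have /= -> := wvtd y; rewrite (deg_contract y) natr_sum.
  by apply: eq_bigr => x _; rewrite wvd.
have wvt_le y : wvt y <= \sum_(x | pr x == y) wv x.
  by rewrite wvtE.
split; first exact: (mw_le_contract wvt_le wetE).
  exact: (spectral_le_uncontract v1_neq_v2 wvtE wetE).
exact: (spectral_le_contract wvt_le wetE).
Qed.
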